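(* Let $\mu$ be a fixed unit pure quaternion, let $\mathcal{A}\in\mathbb{H}^{n_1\times n_2\times n_3}$, let $m=\min(n_1,n_2)$, and let $\mathcal{A}=\mathcal{U}*_\mu\mathcal{S}*_\mu\mathcal{V}^*$ be a gQt-SVD of $\mathcal{A}$. For a positive integer $k<m$ put $$\mathcal{A}_k=\sum_{i=1}^{k}\mathcal{U}(:,i,:)*_\mu\mathcal{S}(i,i,:)*_\mu\mathcal{V}(:,i,:)^*.$$ Then $$\mathcal{A}_k\in\arg\min_{\mathcal{C}\in M_k}\|\mathcal{A}-\mathcal{C}\|_F,\qquad M_k=\{\mathcal{X}*_\mu\mathcal{Y}\ :\ \mathcal{X}\in\mathbb{H}^{n_1\times k\times n_3},\ \mathcal{Y}\in\mathbb{H}^{k\times n_2\times n_3}\}.$$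
   Context: $\mathbb{H}$ is the real quaternion algebra with units $\mathbf{i},\mathbf{j},\mathbf{k}$; for a quaternion matrix, $A^*$ is the conjugate transpose. A tensor $\mathcal{A}\in\mathbb{H}^{n_1\times n_2\times n_3}$ is written $\mathcal{A}=\mathcal{A}_{\mathbf e}+\mathcal{A}_{\mathbf i}\mathbf{i}+\mathcal{A}_{\mathbf j}\mathbf{j}+\mathcal{A}_{\mathbf k}\mathbf{k}$ with real tensors $\mathcal{A}_{\mathbf e},\mathcal{A}_{\mathbf i},\mathcal{A}_{\mathbf j},\mathcal{A}_{\mathbf k}$. Its frontal slices are $A^{(k)}=\mathcal{A}(:,:,k)$, and $\|\mathcal{A}\|_F=(\sum|\mathcal{A}_{ijk}|^2)^{1/2}$. $\mathrm{unfold}(\mathcal{A})$ is the $n_1n_3\times n_2$ block column $[A^{(1)};\dots;A^{(n_3)}]$, $\mathrm{fold}$ is its inverse, and $\mathrm{circ}(\mathcal{A})$ is the $n_1n_3\times n_2n_3$ block circulant matrix whose $(p,q)$ block is $A^{(s)}$ with $s\equiv p-q+1 \pmod{n_3}$, $1\le s\le n_3$. Sub-tensors such as $\mathcal{U}(:,i,:)\in\mathbb{H}^{n_1\times1\times n_3}$, $\mathcal{S}(i,i,:)\in\mathbb{H}^{1\times1\times n_3}$, $\mathcal{V}(:,i,:)\in\mathbb{H}^{n_2\times 1\times n_3}$ are regarded as third-order tensors. Fix a unit pure quaternion $\mu=a\mathbf{i}+b\mathbf{j}+c\mathbf{k}$ ($a,b,c$ real, $a^2+b^2+c^2=1$, so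 $\mu^2=-1$). For a unit pure quaternion $\nu$, $F_{\nu,n}\in\mathbb{H}^{n\times n}$ is the matrix with entries $\frac1{\sqrt n}\left(\cos\frac{2\pi(p-1)(q-1)}{n}-\nu\sin\frac{2\pi(p-1)(q-1)}{n}\right)$. The QDFT $\hat{\mathcal{A}}$ of $\mathcal{A}$ is the tensor with $\hat{\mathcal{A}}(i,j,:)=\sqrt{n_3}\,F_{\mu,n_3}\mathcal{A}(i,j,:)$. Put $\mu_{\mathbf i}=a\mathbf{i}-b\mathbf{j}-c\mathbf{k}$, $\mu_{\mathbf j}=-a\mathbf{i}+b\mathbf{j}-c\mathbf{k}$, $\mu_{\mathbf k}=-a\mathbf{i}-b\mathbf{j}+c\mathbf{k}$, and $T_\alpha=F_{\mu_\alpha,n_3}^*F_{\mu,n_3}$ for $\alpha\in\{\mathbf{i},\mathbf{j},\mathbf{k}\}$. gQt-product: for $\mathcal{A}\in\mathbb{H}^{n_1\times r\times n_3}$, $\mathcal{B}\in\mathbb{H}^{r\times n_2\times n_3}$, $\mathcal{A}*_\mu\mathcal{B}=\mathrm{fold}\big((\mathrm{circ}(\mathcal{A}_{\mathbf e})+\mathbf{i}\,\mathrm{circ}(\mathcal{A}_{\mathbf i})(T_{\mathbf i}\otimes I_r)+\mathbf{j}\,\mathrm{circ}(\mathcal{A}_{\mathbf j})(T_{\mathbf j}\otimes I_r)+\mathbf{k}\,\mathrm{circ}(\mathcal{A}_{\mathbf k})(T_{\mathbf k}\otimes I_r))\,\mathrm{unfold}(\mathcal{B})\big)\in\mathbb{H}^{n_1\times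 n_2\times n_3}$. Conjugate transpose: for a real tensor $\mathcal{R}$, $\mathcal{R}^*$ is obtained by transposing each frontal slice and then reversing the order of the transposed slices $2,\dots,n_3$. For a quaternion tensor, $\mathcal{A}^*\in\mathbb{H}^{n_2\times n_1\times n_3}$ is defined by $\mathrm{unfold}(\mathcal{A}^* )=\mathrm{unfold}(\mathcal{A}_{\mathbf e}^* )-(T_{\mathbf i}^*\otimes I_{n_2})\mathrm{unfold}(\mathcal{A}_{\mathbf i}^* )\mathbf{i}-(T_{\mathbf j}^*\otimes I_{n_2})\mathrm{unfold}(\mathcal{A}_{\mathbf j}^* )\mathbf{j}-(T_{\mathbf k}^*\otimes I_{n_2})\mathrm{unfold}(\mathcal{A}_{\mathbf k}^* )\mathbf{k}$. gQt-SVD: a factorization $\mathcal{A}=\mathcal{U}*_\mu\mathcal{S}*_\mu\mathcal{V}^*$ with $\mathcal{U}\in\mathbb{H}^{n_1\times n_1\times n_3}$, $\mathcal{S}\in\mathbb{H}^{n_1\times n_2\times n_3}$, $\mathcal{V}\in\mathbb{H}^{n_2\times n_2\times n_3}$ obtained from quaternion SVDs of the slices of $\hat{\mathcal{A}}$: for every $q\in\{1,\dots,n_3\}$, $\hat{\mathcal{A}}(:,:,q)=\hat{\mathcal{U}}(:,:,q)\hat{\mathcal{S}}(:,:,q)\hat{\mathcal{V}}(:,:,q)^*$ where $\hat{\mathcal{U}}(:,:,q)$ and $\hat{\mathcal{V}}(:,:,q)$ are unitary quaternion matrices and $\hat{\mathcal{S}}(:,:,q)$ is a real nonnegative rectangular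 diagonal matrix with nonincreasing diagonal entries. *)

(* Defs.v *)
From HB Require Import structures.
From mathcomp Require Import all_boot all_order all_algebra.
From mathcomp Require Import classical_sets reals trigo.
From mathcomp Require Import mxtens.
From mathcomp Require Import ring.

Set Implicit Arguments.
Unset Strict Implicit.
Unset Printing Implicit Defensive.

Import Order.TTheory GRing.Theory Num.Theory.

Local Open Scope ring_scope.

(** * The quaternion ring *)

Record quat (R : Type) : Type := Quat {qre : R; qi : R; qj : R; qk : R}.

Section QuatChoice.

Definition quat_tuple (R : Type) (x : quat R) : R * R * R * R :=
  (qre x, qi x, qj x, qk x).

Definition tuple_quat (R : Type) (t : R * R * R * R) : quat R :=
  Quat t.1.1.1 t.1.1.2 t.1.2 t.2.

Lemma quat_tupleK (R : Type) : cancel (@quat_tuple R) (@tuple_quat R).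
Proof. by case. Qed.

HB.instance Definition _ (R : eqType) :=
  Equality.copy (quat R) (can_type (@quat_tupleK R)).
HB.instance Definition _ (R : choiceType) :=
  Choice.copy (quat R) (can_type (@quat_tupleK R)).

End QuatChoice.

Section QuatZmodule.
Variable R : zmodType.

Definition addq (x y : quat R) : quat R :=
  Quat (qre x + qre y) (qi x + qi y) (qj x + qj y) (qk x + qk y).

Definition oppq (x : quat R) : quat R :=
  Quat (- qre x) (- qi x) (- qj x) (- qk x).

Lemma addqA : associative addq.
Proof. by move=> x y z; congr Quat; rewrite /= addrA. Qed.

Lemma addqC : commutative addq.
Proof. by move=> x y; congr Quat; rewrite /= addrC. Qed.

Lemma add0q : left_id (Quat 0 0 0 0) addq.
Proof. by case=> a b c d; congr Quat; rewrite /= add0r. Qed.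

Lemma addNq : left_inverse (Quat 0 0 0 0) oppq addq.
Proof. by move=> x; congr Quat; rewrite /= addNr. Qed.

HB.instance Definition _ :=
  GRing.isZmodule.Build (quat R) addqA addqC add0q addNq.

End QuatZmodule.

Section QuatRing.
Variable R : comNzRingType.

Definition mulq (x y : quat R) : quat R :=
  Quat (qre x * qre y - qi x * qi y - qj x * qj y - qk x * qk y)
       (qre x * qi y + qi x * qre y + qj x * qk y - qk x * qj y)
       (qre x * qj y - qi x * qk y + qj x * qre y + qk x * qi y)
       (qre x * qk y + qi x * qj y - qj x * qi y + qk x * qre y).

Lemma mulqA : associative mulq.
Proof. by move=> x y z; congr Quat => /=; ring. Qed.

Lemma mul1q : left_id (Quat 1 0 0 0) mulq.
Proof. by case=> a b c d; congr Quat => /=; ring. Qed.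

Lemma mulq1 : right_id (Quat 1 0 0 0) mulq.
Proof. by case=> a b c d; congr Quat => /=; ring. Qed.

Lemma mulqDl : left_distributive mulq +%R.
Proof. by move=> x y z; congr Quat => /=; ring. Qed.

Lemma mulqDr : right_distributive mulq +%R.
Proof. by move=> x y z; congr Quat => /=; ring. Qed.

Lemma oneq_neq0 : Quat 1 0 0 0 != 0 :> quat R.
Proof. by apply/eqP => -[] /eqP; rewrite oner_eq0. Qed.

HB.instance Definition _ :=
  GRing.Zmodule_isNzRing.Build (quat R)
    mulqA mul1q mulq1 mulqDl mulqDr oneq_neq0.

Definition realq (x : R) : quat R := Quat x 0 0 0.
Definition iq : quat R := Quat 0 1 0 0.
Definition jq : quat R := Quat 0 0 1 0.
Definition kq : quat R := Quat 0 0 0 1.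

Definition conjq (x : quat R) : quat R :=
  Quat (qre x) (- qi x) (- qj x) (- qk x).

Definition normq2 (x : quat R) : R :=
  qre x ^+ 2 + qi x ^+ 2 + qj x ^+ 2 + qk x ^+ 2.

Definition unit_pure (x : quat R) : Prop :=
  qre x = 0 /\ qi x ^+ 2 + qj x ^+ 2 + qk x ^+ 2 = 1.

Definition adjq m n (M : 'M[quat R]_(m, n)) : 'M[quat R]_(n, m) :=
  (map_mx conjq M)^T.

Definition unitaryq n (M : 'M[quat R]_n) : Prop :=
  M *m adjq M = 1%:M /\ adjq M *m M = 1%:M.

(* Multiplication by a scalar on the right; [*:] multiplies on the left. *)
Definition scalemxr m n (M : 'M[quat R]_(m, n)) (x : quat R) :
  'M[quat R]_(m, n) := map_mx (fun y => y * x) M.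

End QuatRing.

Arguments iq {R}.
Arguments jq {R}.
Arguments kq {R}.

(** * Third-order tensors *)

(* An n1 x n2 x n3 tensor is the family of its frontal slices; slice A^(s) of
   the literature is [A p] with p = s - 1. *)
Notation tensor K n1 n2 n3 := {ffun 'I_n3 -> 'M[K]_(n1, n2)}.

Section ModularIndices.
Variable n : nat.

Lemma ordsub_subproof (p q : 'I_n) : ((p + (n - q)) %% n < n)%N.
Proof. by rewrite ltn_pmod // (leq_ltn_trans (leq0n p)). Qed.

Lemma ordopp_subproof (p : 'I_n) : ((n - p) %% n < n)%N.
Proof. by rewrite ltn_pmod // (leq_ltn_trans (leq0n p)). Qed.

(* Subtraction and opposite modulo n, also when n is not syntactically a
   successor. *)
Definition ordsub (p q : 'I_n) : 'I_n := Ordinal (ordsub_subproof p q).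
Definition ordopp (p : 'I_n) : 'I_n := Ordinal (ordopp_subproof p).

End ModularIndices.

Section Tensor.
Variables (K : Type) (n1 n2 n3 : nat).

(* The block structure of 'M_(n3 * n1, _) is the one of the Kronecker product
   [tensmx]: row i of block p has index [mxtens_index (p, i)]. *)
Definition unfold (A : tensor K n1 n2 n3) : 'M[K]_(n3 * n1, n2) :=
  \matrix_(r, j) A (mxtens_unindex r).1 (mxtens_unindex r).2 j.

Definition fold (M : 'M[K]_(n3 * n1, n2)) : tensor K n1 n2 n3 :=
  [ffun p => \matrix_(i, j) M (mxtens_index (p, i)) j].

Definition circ (A : tensor K n1 n2 n3) : 'M[K]_(n3 * n1, n3 * n2) :=
  \matrix_(r, c) A (ordsub (mxtens_unindex r).1 (mxtens_unindex c).1)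
                   (mxtens_unindex r).2 (mxtens_unindex c).2.

(* [ordopp] fixes slice 0 and reverses the order of the others. *)
Definition ttr (A : tensor K n1 n2 n3) : tensor K n2 n1 n3 :=
  [ffun p => (A (ordopp p))^T].

Definition tube (A : tensor K n1 n2 n3) (i : 'I_n1) (j : 'I_n2) : 'cV[K]_n3 :=
  \col_p A p i j.

(* A(:,i,:) *)
Definition tlateral (A : tensor K n1 n2 n3) (j : 'I_n2) : tensor K n1 1 n3 :=
  [ffun p => col j (A p)].

(* A(i,j,:) *)
Definition ttube (A : tensor K n1 n2 n3) (i : 'I_n1) (j : 'I_n2) :
  tensor K 1 1 n3 := [ffun p => const_mx (A p i j)].

Definition tmap (L : Type) (f : K -> L) (A : tensor K n1 n2 n3) :
  tensor L n1 n2 n3 := [ffun p => map_mx f (A p)].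

End Tensor.

(** * The gQt-product *)

Section GQt.
Variable R : realType.
Local Notation H := (quat R).

(* F_{nu,n}; the indices p and q are already shifted to start from 0. *)
Definition qdftmx (nu : H) (n : nat) : 'M[H]_n :=
  \matrix_(p, q)
    let theta := 2 * pi * (p * q)%:R / n%:R in
    realq (Num.sqrt n%:R)^-1 * (realq (cos theta) - nu * realq (sin theta)).

Definition qdft (mu : H) n1 n2 n3 (A : tensor H n1 n2 n3) :
  tensor H n1 n2 n3 :=
  [ffun p => \matrix_(i, j)
     (realq (Num.sqrt n3%:R) *: (qdftmx mu n3 *m tube A i j)) p 0].

Definition mui (mu : H) : H := Quat 0 (qi mu) (- qj mu) (- qk mu).
Definition muj (mu : H) : H := Quat 0 (- qi mu) (qj mu) (- qk mu).
Definition muk (mu : H) : H := Quat 0 (- qi mu) (- qj mu) (qk mu).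

(* F_{nu,n}^* F_{mu,n} *)
Definition Tmx (nu mu : H) (n : nat) : 'M[H]_n :=
  adjq (qdftmx nu n) *m qdftmx mu n.

Definition gqt_mul (mu : H) n1 r n2 n3
    (A : tensor H n1 r n3) (B : tensor H r n2 n3) : tensor H n1 n2 n3 :=
  let rcirc (f : H -> R) := map_mx (@realq R) (circ (tmap f A)) in
  let TI (nu : H) : 'M[H]_(n3 * r) := Tmx nu mu n3 *t 1%:M in
  fold ((rcirc (@qre R)
         + iq *: (rcirc (@qi R) *m TI (mui mu))
         + jq *: (rcirc (@qj R) *m TI (muj mu))
         + kq *: (rcirc (@qk R) *m TI (muk mu))) *m unfold B).

Definition gqt_adj (mu : H) n1 n2 n3 (A : tensor H n1 n2 n3) :
  tensor H n2 n1 n3 :=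
  let runf (f : H -> R) := map_mx (@realq R) (unfold (ttr (tmap f A))) in
  let TI (nu : H) : 'M[H]_(n3 * n2) := adjq (Tmx nu mu n3) *t 1%:M in
  fold (runf (@qre R)
        - scalemxr (TI (mui mu) *m runf (@qi R)) iq
        - scalemxr (TI (muj mu) *m runf (@qj R)) jq
        - scalemxr (TI (muk mu) *m runf (@qk R)) kq).

Definition tnorm n1 n2 n3 (A : tensor H n1 n2 n3) : R :=
  Num.sqrt (\sum_(p < n3) \sum_(i < n1) \sum_(j < n2) normq2 (A p i j)).

(** * The gQt-SVD and truncation *)

Definition singular_value_mx m n (S : 'M[H]_(m, n)) : Prop :=
  [/\ forall (i : 'I_m) (j : 'I_n), i <> j :> nat -> S i j = 0,
      forall (i : 'I_m) (j : 'I_n), i = j :> nat ->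
        S i j = realq (qre (S i j)) /\ 0 <= qre (S i j)
    & forall (i i' : 'I_m) (j j' : 'I_n), i = j :> nat -> i' = j' :> nat ->
        (i <= i')%N -> qre (S i' j') <= qre (S i j)].

Definition is_gqt_svd (mu : H) n1 n2 n3 (A : tensor H n1 n2 n3)
    (U : tensor H n1 n1 n3) (S : tensor H n1 n2 n3) (V : tensor H n2 n2 n3) :
    Prop :=
  A = gqt_mul mu (gqt_mul mu U S) (gqt_adj mu V) /\
  forall q : 'I_n3,
    [/\ qdft mu A q = qdft mu U q *m qdft mu S q *m adjq (qdft mu V q),
        unitaryq (qdft mu U q), unitaryq (qdft mu V q)
      & singular_value_mx (qdft mu S q)].

Lemma ltn_minn_leql k n1 n2 : (k < minn n1 n2)%N -> (k <= n1)%N.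
Proof. by rewrite leq_min => /andP[/ltnW]. Qed.

Lemma ltn_minn_leqr k n1 n2 : (k < minn n1 n2)%N -> (k <= n2)%N.
Proof. by rewrite leq_min => /andP[_ /ltnW]. Qed.

Definition gqt_trunc (mu : H) n1 n2 n3 (U : tensor H n1 n1 n3)
    (S : tensor H n1 n2 n3) (V : tensor H n2 n2 n3)
    k (hk : (k < minn n1 n2)%N) : tensor H n1 n2 n3 :=
  \sum_(i < k)
    let i1 := widen_ord (ltn_minn_leql hk) i in
    let i2 := widen_ord (ltn_minn_leqr hk) i in
    gqt_mul mu (gqt_mul mu (tlateral U i1) (ttube S i1 i2))
               (gqt_adj mu (tlateral V i2)).

Definition gqt_factorizable (mu : H) n1 n2 n3 (k : nat) :
  set (tensor H n1 n2 n3) :=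
  [set C | exists (X : tensor H n1 k n3) (Y : tensor H k n2 n3),
     C = gqt_mul mu X Y]%classic.

Definition argmin (T : Type) (f : T -> R) (M : set T) : set T :=
  [set x | M x /\ forall y, M y -> f x <= f y]%classic.

End GQt.

(* Main.v *)
Require Import Defs.
From HB Require Import structures.
From mathcomp Require Import all_boot all_order all_algebra.
From mathcomp Require Import classical_sets reals trigo.
From mathcomp Require Import mxtens.
From mathcomp Require Import ring lra.

Set Implicit Arguments.
Unset Strict Implicit.
Unset Printing Implicit Defensive.

Import Order.TTheory GRing.Theory Num.Theory.

Local Open Scope ring_scope.

(** Frobenius-optimality of the truncation is checked slice by slice after the
    transform along the third index.  The transform used here, [dft nu], is
    defined for every unit pure quaternion [nu]; its weights are the powers of
    the [n]-th root of unity [cos (2 pi / n) - nu sin (2 pi / n)], which lie in a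
    copy of the complex field inside the quaternions.  Orthogonality of these
    powers ([qroot_orthogonal]) yields Parseval's identity ([parseval]), hence
    injectivity ([dft_inj]), and it lets norm inequalities be proved on the
    transformed slices ([tnorm_le_dft]).

    The product and the conjugate transpose of tensors are built so that the
    transform along [mu] turns them into the slicewise matrix product and
    adjoint ([dft_gqt_mul], [dft_gqt_adj]).  Real parts obey the classical
    convolution theorem ([dft_conv]).  For an imaginary unit [u], the relation
    [mu * u = u * nu] moves [u] out of the transform along [mu] and leaves the
    transform along [nu] behind ([dft_twist]), where [nu] is [mui mu], [muj mu]
    or [muk mu].  The matrices [Tmx nu mu] undo exactly this change: they
    replace the transform along [nu] by the one along [mu] ([dft_Tmx]).

    On one slice the claim is the Eckart-Young theorem in the Frobenius norm
    over the quaternions ([eckart_young]).  By unitary invariance the slice may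
    be taken equal to its diagonal factor [S].  If [P] is the orthogonal
    projection on the column space of [X] ([colspace_orthoproj]), then
    [1 - P] contracts and kills [X *m Y], so the error of [X *m Y] is at least
    the squared norm of [(1 - P) *m S].  The latter is the sum of
    [d i * (1 - p i)], where [d i] is the [i]-th squared singular value and
    [p i] the [i]-th diagonal entry of [P].  These weights lie between 0 and 1
    and their sum, the trace of [P], is at most [k]; the sum of [d i * p i] is
    therefore largest when all the weight sits on the [k] largest [d i]
    ([weighted_sum_le_top]), and this is the case of the truncation.

    Finally, column selection commutes with the transform, so the transformed
    truncation is the truncated slice ([dft_gqt_trunc], [mxsub_truncproj]), and
    the truncation is the product of the tensor of the first [k] columns of [U],
    scaled by the corner of [S], with the adjoint of the first [k] columns of
    [V] ([gqt_trunc_factorizable]). *)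

(** * Quaternions, adjoints and the Frobenius norm *)

Section QuaternionAlgebra.
Variable R : realType.
Local Notation H := (quat R).
Implicit Types (x y : H) (a : R).

Lemma quatP x y :
  qre x = qre y -> qi x = qi y -> qj x = qj y -> qk x = qk y -> x = y.
Proof. by case: x y => ? ? ? ? [? ? ? ?] /= -> -> -> ->. Qed.

Lemma qre_is_zmod_morphism : zmod_morphism (@qre R). Proof. by []. Qed.
HB.instance Definition _ :=
  GRing.isZmodMorphism.Build H R (@qre R) qre_is_zmod_morphism.

Lemma conjq_is_zmod_morphism : zmod_morphism (@conjq R).
Proof. by move=> x y; apply: quatP => //=; ring. Qed.
HB.instance Definition _ :=
  GRing.isZmodMorphism.Build H H (@conjq R) conjq_is_zmod_morphism.

Lemma realq_is_zmod_morphism : zmod_morphism (@realq R).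
Proof. by move=> x y; apply: quatP => //=; ring. Qed.
HB.instance Definition _ :=
  GRing.isZmodMorphism.Build R H (@realq R) realq_is_zmod_morphism.

Lemma realq_is_monoid_morphism : monoid_morphism (@realq R).
Proof. by split=> // x y; apply: quatP => //=; ring. Qed.
HB.instance Definition _ :=
  GRing.isMonoidMorphism.Build R H (@realq R) realq_is_monoid_morphism.

Lemma realq_comm a x : realq a * x = x * realq a.
Proof. by apply: quatP => /=; ring. Qed.

Lemma conjqM x y : conjq (x * y) = conjq y * conjq x.
Proof. by apply: quatP => /=; ring. Qed.

Lemma conjqK : involutive (@conjq R).
Proof. by move=> x; apply: quatP => /=; ring. Qed.

Lemma conjq_realq a : conjq (realq a) = realq a.
Proof. by apply: quatP => /=; ring. Qed.

Lemma qre_mulC x y : qre (x * y) = qre (y * x).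
Proof. by rewrite /=; ring. Qed.

Lemma mul_conjq x : conjq x * x = realq (normq2 x).
Proof. by rewrite /normq2; apply: quatP => /=; ring. Qed.

Lemma normq2_ge0 x : 0 <= normq2 x.
Proof. by rewrite /normq2 !addr_ge0 // sqr_ge0. Qed.

Lemma normq2_eq0 x : (normq2 x == 0) = (x == 0).
Proof.
apply/eqP/eqP => [|->]; last by rewrite /normq2 /=; ring.
rewrite /normq2 => x0.
have := sqr_ge0 (qre x); have := sqr_ge0 (qi x).
have := sqr_ge0 (qj x); have := sqr_ge0 (qk x) => hk hj hi he.
by apply: quatP; apply/eqP; rewrite -sqrf_eq0; apply/eqP=> /=; lra.
Qed.

(** Left multiplication by [conjq x] turns the factor [x] into a nonzero real
    number, which is invertible. *)
Lemma mulq_eq0 x y : x * y = 0 -> x != 0 -> y = 0.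
Proof.
move=> xy0 xN0; have nN0 : normq2 x != 0 by rewrite normq2_eq0.
have: realq (normq2 x) * y = 0 by rewrite -mul_conjq -mulrA xy0 mulr0.
move=> /(congr1 (fun z => realq (normq2 x)^-1 * z)).
by rewrite mulr0 mulrA -rmorphM /= mulVf // rmorph1 mul1r.
Qed.

Section Adjoint.
Variables m n p : nat.
Implicit Types (M N : 'M[H]_(m, n)).

Lemma adjqM M (L : 'M[H]_(n, p)) : adjq (M *m L) = adjq L *m adjq M.
Proof.
apply/matrixP => i j; rewrite !mxE raddf_sum; apply: eq_bigr => l _ /=.
by rewrite !mxE conjqM.
Qed.

Lemma adjqB M N : adjq (M - N) = adjq M - adjq N.
Proof. by apply/matrixP => i j; rewrite !mxE raddfB. Qed.

Lemma adjqD M N : adjq (M + N) = adjq M + adjq N.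
Proof. by apply/matrixP => i j; rewrite !mxE raddfD. Qed.

Lemma adjqK M : adjq (adjq M) = M.
Proof. by apply/matrixP => i j; rewrite !mxE conjqK. Qed.

Lemma adjqZ a M : adjq (realq a *: M) = realq a *: adjq M.
Proof. by apply/matrixP => i j; rewrite !mxE conjqM conjq_realq realq_comm. Qed.

Lemma scale_realq_mulmxr a (L : 'M[H]_(n, p)) M :
  M *m (realq a *: L) = realq a *: (M *m L).
Proof.
apply/matrixP => i j; rewrite !mxE mulr_sumr; apply: eq_bigr => l _.
by rewrite !mxE mulrA -realq_comm mulrA.
Qed.

(** The trace itself is not cyclic over the quaternions, but its real part is;
    this is what makes [frob2] invariant under isometries on both sides. *)
Lemma qre_trC M (L : 'M[H]_(n, m)) : qre (\tr (M *m L)) = qre (\tr (L *m M)).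
Proof.
rewrite /mxtrace !raddf_sum /=.
under eq_bigr do rewrite mxE raddf_sum.
under [RHS]eq_bigr do rewrite mxE raddf_sum.
rewrite exchange_big; apply: eq_bigr => i _; apply: eq_bigr => j _.
exact: qre_mulC.
Qed.

End Adjoint.

Lemma adjq1 n : adjq (1%:M : 'M[H]_n) = 1%:M.
Proof.
apply/matrixP => i j; rewrite !mxE eq_sym; case: (i == j).
  exact: conjq_realq.
exact: raddf0.
Qed.

Definition frob2 m n (M : 'M[H]_(m, n)) : R := \sum_i \sum_j normq2 (M i j).

Lemma adj_mul_diag m n (M : 'M[H]_(m, n)) j :
  (adjq M *m M) j j = realq (\sum_i normq2 (M i j)).
Proof.
by rewrite mxE raddf_sum; apply: eq_bigr => i _; rewrite !mxE mul_conjq.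
Qed.

Lemma frob2E m n (M : 'M[H]_(m, n)) : frob2 M = qre (\tr (adjq M *m M)).
Proof.
rewrite /frob2 exchange_big /mxtrace raddf_sum /=; apply: eq_bigr => j _.
by rewrite adj_mul_diag.
Qed.

Lemma frob2_ge0 m n (M : 'M[H]_(m, n)) : 0 <= frob2 M.
Proof. by do 2!apply: sumr_ge0 => ? _; apply: normq2_ge0. Qed.

Lemma frob2_0 m n : frob2 (0 : 'M[H]_(m, n)) = 0.
Proof.
by rewrite /frob2; do 2!(apply: big1 => ? _); rewrite mxE /normq2 /= !expr0n /= !addr0.
Qed.

Lemma frob2_eq0 m p (M : 'M[H]_(m, p)) : frob2 M = 0 -> M = 0.
Proof.
move=> M0; apply/matrixP => i j; rewrite mxE; apply/eqP; rewrite -normq2_eq0.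
have rowM_ge0 l : 0 <= \sum_j normq2 (M l j).
  by apply: sumr_ge0 => ? _; apply: normq2_ge0.
have row0 := psumr_eq0P (fun l _ => rowM_ge0 l) M0.
apply/eqP/(psumr_eq0P _ (row0 i isT)) => // l _; exact: normq2_ge0.
Qed.

Lemma frob2_isometryl m n p (W : 'M[H]_(m, n)) (M : 'M[H]_(n, p)) :
  adjq W *m W = 1%:M -> frob2 (W *m M) = frob2 M.
Proof.
by move=> WW; rewrite !frob2E adjqM mulmxA -(mulmxA _ (adjq W)) WW mulmx1.
Qed.

Lemma frob2_isometryr m n p (W : 'M[H]_(p, n)) (M : 'M[H]_(m, n)) :
  adjq W *m W = 1%:M -> frob2 (M *m adjq W) = frob2 M.
Proof.
move=> WW; rewrite !frob2E qre_trC adjqM adjqK mulmxA -(mulmxA M) WW mulmx1.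
exact: qre_trC.
Qed.

End QuaternionAlgebra.

(** * Best approximation of bounded rank for quaternion matrices *)

Section LowRankApproximation.
Variable R : realType.
Local Notation H := (quat R).

Definition orthoproj n (P : 'M[H]_n) : Prop := adjq P = P /\ P *m P = P.

Lemma orthoproj_compl n (P : 'M[H]_n) : orthoproj P -> orthoproj (1%:M - P).
Proof.
case=> Pa PP; split; first by rewrite adjqB adjq1 Pa.
by rewrite mulmxBl mul1mx mulmxBr mulmx1 PP subrr subr0.
Qed.

Lemma orthoproj_diag_ge0 n (P : 'M[H]_n) i : orthoproj P -> 0 <= qre (P i i).
Proof.
case=> Pa PP; rewrite -PP -{1}Pa adj_mul_diag.
by apply: sumr_ge0 => j _; apply: normq2_ge0.
Qed.

Lemma orthoproj_diag_le1 n (P : 'M[H]_n) i : orthoproj P -> qre (P i i) <= 1.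
Proof.
move=> /orthoproj_compl /(orthoproj_diag_ge0 i).
by rewrite !mxE eqxx raddfB /= subr_ge0.
Qed.

Lemma frob2_orthoproj m n (P : 'M[H]_m) (M : 'M[H]_(m, n)) :
  orthoproj P -> frob2 (P *m M) = qre (\tr (adjq M *m (P *m M))).
Proof. by case=> Pa PP; rewrite frob2E adjqM Pa -mulmxA (mulmxA P) PP. Qed.

(** Pythagoras: the missing part of [frob2 M] is the squared norm of
    [(1 - P) *m M]. *)
Lemma frob2_orthoproj_le m n (P : 'M[H]_m) (M : 'M[H]_(m, n)) :
  orthoproj P -> frob2 (P *m M) <= frob2 M.
Proof.
move=> Pp; rewrite -subr_ge0 frob2_orthoproj // frob2E -raddfB -raddfB /=.
rewrite -mulmxBr -[X in X - _]mul1mx -mulmxBl -frob2_orthoproj ?frob2_ge0 //.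
exact: orthoproj_compl.
Qed.

Lemma mul_mx_scalar_realq m n a (M : 'M[H]_(m, n)) :
  M *m (realq a)%:M = realq a *: M.
Proof. by rewrite -[RHS]mulmx1 -scalemxAl -scale_realq_mulmxr scalemx1. Qed.

(** A Gram-Schmidt process that records only the projection: adding a column [x]
    with residue [y = x - P *m x] adds to [P] the projection [y y^* / |y|^2] on
    the line of [y], whose trace is 1. *)
Lemma colspace_orthoproj n k (X : 'M[H]_(n, k)) :
  exists P : 'M[H]_n,
    [/\ orthoproj P, P *m X = X & qre (\tr P) <= k%:R].
Proof.
elim: k X => [|k IHk]; last rewrite -add1n; move=> X.
  exists 0; split; last by rewrite mxtrace0.
    by split; [apply/matrixP => i j; rewrite !mxE raddf0 | rewrite mul0mx].
  by apply/matrixP => i [].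
have [P [[Pa PP] PX trP]] := IHk (rsubmx X).
set x := lsubmx X in PX *; set X' := rsubmx _ in PX.
have -> : X = row_mx x X' by rewrite hsubmxK.
pose y := x - P *m x.
have Py : P *m y = 0 by rewrite mulmxBr mulmxA PP subrr.
have yP : adjq y *m P = 0.
  by rewrite -Pa -adjqM Py; apply/matrixP => i j; rewrite !mxE raddf0.
have yX' : adjq y *m X' = 0 by rewrite -PX mulmxA yP mul0mx.
have [y0|yN0] := eqVneq y 0.
  exists P; split=> //; last by rewrite (le_trans trP) // ler_nat leq_addl.
  by rewrite mul_mx_row PX; congr row_mx; apply/esym/eqP; rewrite -subr_eq0 -/y y0.
pose c := frob2 y.
have yy : adjq y *m y = (realq c)%:M.
  apply/matrixP => i j; rewrite !ord1 adj_mul_diag !mxE eqxx mulr1n /c /frob2.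
  by congr realq; apply: eq_bigr => i' _; rewrite big_ord1.
have cN0 : c != 0.
  apply: contraNneq yN0 => c0; apply/eqP/matrixP => i j; rewrite ord1 [RHS]mxE.
  have := adj_mul_diag y 0; rewrite yy c0 [LHS]mxE eqxx => -[] /esym/psumr_eq0P col0.
  by apply/eqP; rewrite -normq2_eq0 col0 // => l _; apply: normq2_ge0.
have cK : realq c^-1 * realq c = 1 by rewrite -rmorphM /= mulVf.
(* [Z] is [c] times the projection on the line of [y]. *)
pose Z := y *m adjq y.
have PZ : P *m Z = 0 by rewrite mulmxA Py mul0mx.
have ZP : Z *m P = 0 by rewrite -mulmxA yP mulmx0.
have ZZ : Z *m Z = realq c *: Z.
  by rewrite -mulmxA (mulmxA (adjq y)) yy mul_scalar_mx scale_realq_mulmxr.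
have ZX' : Z *m X' = 0 by rewrite -mulmxA yX' mulmx0.
have Zx : Z *m x = realq c *: y.
  rewrite -mulmxA.
  have -> : adjq y *m x = (realq c)%:M.
    by rewrite -yy [in RHS]/y mulmxBr mulmxA yP mul0mx subr0.
  by rewrite mul_mx_scalar_realq.
exists (P + realq c^-1 *: Z); split.
- split; first by rewrite adjqD adjqZ adjqM adjqK Pa.
  rewrite mulmxDl !mulmxDr PP !scale_realq_mulmxr -!scalemxAl PZ ZP ZZ.
  by rewrite !scaler0 addr0 add0r (scalerA (realq c^-1) (realq c)) cK scale1r.
- rewrite mul_mx_row !mulmxDl PX -!scalemxAl ZX' Zx scaler0 addr0.
  by rewrite scalerA cK scale1r addrC subrK.
- rewrite raddfD raddfD /= mxtraceZ natrD addrC lerD //.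
  have -> : \tr Z = realq (\sum_i normq2 (y i 0)).
    rewrite /mxtrace raddf_sum; apply: eq_bigr => i _.
    by rewrite !mxE big_ord1 !mxE /normq2; apply: quatP => /=; ring.
  rewrite (_ : \sum_i _ = c) ?cK //.
  by rewrite /c /frob2; apply: eq_bigr => i _; rewrite big_ord1.
Qed.

(** With [t = d k] as threshold, [(d i - t) * p i] is at most [d i - t] for
    [i < k] and at most 0 for the other indices, by the monotonicity of [d]. *)
Lemma weighted_sum_le_top n k (d p : 'I_n -> R) :
    (k < n)%N -> (forall i, 0 <= d i) ->
    (forall i j : 'I_n, (i <= j)%N -> d j <= d i) ->
    (forall i, 0 <= p i <= 1) -> \sum_i p i <= k%:R ->
  \sum_i d i * p i <= \sum_i d i * (i < k)%:R.
Proof.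
move=> kn d0 dmono p01 psum; pose t := d (Ordinal kn).
have sumk : \sum_(i < n) ((i < k)%:R : R) = k%:R.
  transitivity (\sum_(i < k) (1 : R)); last by rewrite sumr_const card_ord.
  rewrite (big_ord_widen n (fun=> 1)) ?[RHS]big_mkcond; last exact: ltnW.
  by apply: eq_bigr => i _; case: ltnP.
have bnd i : d i * p i <= t * p i + (d i - t) * (i < k)%:R.
  have /andP[pi0 pi1] := p01 i.
  have [ik|ki] := ltnP i k.
    have : t <= d i by apply: dmono => /=; exact: ltnW.
    by move=> td; rewrite mulr1; nra.
  have : d i <= t by apply: dmono.
  by move=> dt; rewrite mulr0; nra.
apply: (le_trans (ler_sum _ (fun i _ => bnd i))).
rewrite big_split /= -mulr_sumr.
under [X in _ + X]eq_bigr do rewrite mulrBl.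
rewrite sumrB -mulr_sumr sumk addrCA gerDl.
by rewrite subr_le0 ler_wpM2l // d0.
Qed.

(** The squared norm is the real trace of [Q *m (S *m adjq S)], and the second
    factor is real diagonal. *)
Lemma frob2_orthoproj_diag m n (Q : 'M[H]_m) (S : 'M[H]_(m, n)) :
    orthoproj Q -> (forall (i : 'I_m) (j : 'I_n), i <> j :> nat -> S i j = 0) ->
  frob2 (Q *m S) = \sum_i qre (Q i i) * \sum_j normq2 (S i j).
Proof.
move=> Qp Sd; rewrite frob2_orthoproj // qre_trC -mulmxA /mxtrace raddf_sum /=.
apply: eq_bigr => i _; rewrite mxE (bigD1 i) //= big1 => [|l li].
  have := adj_mul_diag (adjq S) i; rewrite adjqK => ->.
  rewrite addr0 /= !mulr0 !subr0; congr (_ * _).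
  by apply: eq_bigr => j _; rewrite !mxE /normq2 /= !sqrrN.
rewrite [X in _ * X]mxE big1 ?mulr0 // => j _; rewrite !mxE.
have [lj|lj] := eqVneq (l : nat) j; last by rewrite (Sd l) ?mul0r //; apply/eqP.
rewrite (Sd i) ?raddf0 ?mulr0 // -lj => il.
by case/eqP: li; apply/val_inj.
Qed.

Definition truncproj n k : 'M[H]_n := diag_mx (\row_i realq (i < k)%:R).

Lemma truncproj_ortho n k : orthoproj (truncproj n k).
Proof.
split; apply/matrixP => i j.
  rewrite !mxE eq_sym; case: eqP => [->|_]; first exact: conjq_realq.
  exact: raddf0.
rewrite mul_diag_mx !mxE; case: (_ == _); rewrite ?mulr0 //.
by rewrite !mulr1n -rmorphM; case: (_ < _)%N; rewrite /= ?mulr0 ?mulr1.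
Qed.

(** The squared norm of row [i] is the [i]-th squared singular value when
    [i < n], and zero for the rows below the diagonal. *)
Lemma singular_value_rows m n (S : 'M[H]_(m, n)) (i i' : 'I_m) :
    singular_value_mx S -> (i <= i')%N ->
  \sum_j normq2 (S i' j) <= \sum_j normq2 (S i j).
Proof.
case=> Sd Sr Sm ii'.
have row (l : 'I_m) (ln : (l < n)%N) :
    \sum_j normq2 (S l j) = qre (S l (Ordinal ln)) ^+ 2.
  rewrite (bigD1 (Ordinal ln)) //= big1 => [|j jl].
    by have [-> _] := Sr l (Ordinal ln) erefl; rewrite /normq2 /= !expr0n /= !addr0.
  rewrite Sd ?/normq2 /= ?expr0n ?addr0 // => lj.
  by case/eqP: jl; apply/val_inj.
have [i'n|ni'] := ltnP i' n.
  have ln := leq_ltn_trans ii' i'n.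
  rewrite (row _ i'n) (row _ ln) ler_sqr ?nnegrE; first exact: Sm.
    by have [] := Sr i' (Ordinal i'n) erefl.
  by have [] := Sr i (Ordinal ln) erefl.
rewrite big1 => [|j _]; first by apply: sumr_ge0 => j _; apply: normq2_ge0.
rewrite Sd ?/normq2 /= ?expr0n ?addr0 // => i'j.
by have := ltn_ord j; rewrite -i'j ltnNge ni'.
Qed.

(** Both errors are sums of [d i] weighted by the diagonal of an orthogonal
    projection: the complement of the column space of [X] bounds the error of
    [X *m Y] from below, the complement of the first [k] coordinates computes
    the error of the truncation. *)
Lemma eckart_young_diag m n k (S : 'M[H]_(m, n)) (X : 'M[H]_(m, k))
    (Y : 'M[H]_(k, n)) :
    singular_value_mx S -> (k < m)%N ->
  frob2 (S - truncproj m k *m S) <= frob2 (S - X *m Y).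
Proof.
move=> Ssv km; have [P [Pp PX trP]] := colspace_orthoproj X.
have [Sd _ _] := Ssv; have Qp := orthoproj_compl Pp.
apply: le_trans (frob2_orthoproj_le _ Qp).
have -> : (1%:M - P) *m (S - X *m Y) = (1%:M - P) *m S.
  rewrite mulmxBr [_ *m (X *m Y)]mulmxA [_ *m X]mulmxBl mul1mx PX subrr.
  by rewrite mul0mx subr0.
have -> : S - truncproj m k *m S = (1%:M - truncproj m k) *m S.
  by rewrite mulmxBl mul1mx.
rewrite !frob2_orthoproj_diag //; last exact/orthoproj_compl/truncproj_ortho.
pose d i := \sum_j normq2 (S i j); rewrite -/d.
have compl_sum (Q : 'M[H]_m) : \sum_i qre ((1%:M - Q) i i) * d i =
    \sum_i d i - \sum_i d i * qre (Q i i).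
  rewrite -sumrB; apply: eq_bigr => i _.
  by rewrite !mxE eqxx raddfB /= mulrBl mul1r [X in _ - X]mulrC.
rewrite !compl_sum lerD2l lerN2.
under [leRHS]eq_bigr do rewrite !mxE eqxx mulr1n /=.
apply: weighted_sum_le_top => //.
- by move=> i; apply: sumr_ge0 => j _; apply: normq2_ge0.
- by move=> i j; apply: singular_value_rows.
- by move=> i; rewrite orthoproj_diag_ge0 // orthoproj_diag_le1.
- by move: trP; rewrite /mxtrace raddf_sum.
Qed.

Lemma eckart_young m n k (U : 'M[H]_m) (S : 'M[H]_(m, n)) (V : 'M[H]_n)
    (X : 'M[H]_(m, k)) (Y : 'M[H]_(k, n)) :
    unitaryq U -> unitaryq V -> singular_value_mx S -> (k < m)%N ->
  frob2 (U *m S *m adjq V - U *m (truncproj m k *m S) *m adjq V)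
    <= frob2 (U *m S *m adjq V - X *m Y).
Proof.
case=> UU' U'U [VV' V'V] Ssv km.
have -> : X *m Y = U *m ((adjq U *m X) *m (Y *m V)) *m adjq V.
  by rewrite !mulmxA UU' mul1mx -!mulmxA VV' mulmx1.
have factor (M : 'M[H]_(m, n)) : frob2 (U *m S *m adjq V - U *m M *m adjq V) =
    frob2 (S - M).
  by rewrite -mulmxBl -mulmxBr (frob2_isometryr _ V'V) (frob2_isometryl _ U'U).
rewrite [leLHS]factor [leRHS]factor; exact: eckart_young_diag.
Qed.

End LowRankApproximation.

(** * Quaternionic roots of unity and the discrete Fourier transform *)

Section RootsOfUnity.
Variable R : realType.
Local Notation H := (quat R).

Definition phase (nu : H) (t : R) : H :=
  realq (cos t) - nu * realq (sin t).

Definition qroot (nu : H) (n m : nat) : H := phase nu (2 * pi * m%:R / n%:R).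

(** The sine and the cosine are real, so [u] commutes with everything in
    [phase nu t] but [nu]. *)
Lemma phase_twist (nu nu' u : H) t :
  nu * u = u * nu' -> phase nu t * u = u * phase nu' t.
Proof.
move=> uP; rewrite mulrBl mulrBr realq_comm; congr (_ - _).
by rewrite -!mulrA realq_comm !mulrA uP.
Qed.

Section FixedUnit.
Variable nu : H.
Hypothesis nuP : unit_pure nu.

Lemma unit_pure_sqr : nu * nu = - 1.
Proof. case: nuP => r0 n1; apply: quatP => /=; rewrite r0; lra. Qed.

Lemma phase0 : phase nu 0 = 1.
Proof. by rewrite /phase cos0 sin0 raddf0 mulr0 subr0. Qed.

Lemma phaseD s t : phase nu (s + t) = phase nu s * phase nu t.
Proof.
rewrite /phase sinD cosD !mulrBl !mulrBr !rmorphB !rmorphD !rmorphM /=.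
rewrite opprB addrA addrAC -!addrA; congr (_ + _).
rewrite mulrA -(realq_comm _ nu) -!mulrA.
rewrite (mulrA nu nu) unit_pure_sqr.
apply: quatP => /=; ring.
Qed.

Lemma conj_phase t : conjq (phase nu t) = phase nu (- t).
Proof.
by case: nuP => r0 _; rewrite /phase cosN sinN; apply: quatP => /=; rewrite r0; ring.
Qed.

Variable n : nat.
Hypothesis n0 : (0 < n)%N.
Local Notation w := (qroot nu n).

Let nR0 : n%:R != 0 :> R. Proof. by rewrite pnatr_eq0 -lt0n. Qed.

Lemma qroot0 : w 0 = 1.
Proof. by rewrite /qroot mulr0 mul0r phase0. Qed.

Lemma qrootD l m : w (l + m) = w l * w m.
Proof. by rewrite /qroot natrD mulrDr mulrDl phaseD. Qed.

Lemma qrootM l m : w (l * m) = w m ^+ l.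
Proof. by elim: l => [|l IHl]; rewrite ?mul0n ?qroot0 // mulSn qrootD IHl exprS. Qed.

Lemma qroot_period : w n = 1.
Proof.
rewrite /qroot mulfK // mulr_natl /phase cos2pi sin2pi.
by rewrite raddf0 mulr0 subr0.
Qed.

Lemma qroot_mod m : w (m %% n) = w m.
Proof.
by rewrite [in RHS](divn_eq m n) qrootD qrootM qroot_period expr1n mul1r.
Qed.

Lemma mul_qroot_conj m : w m * conjq (w m) = 1.
Proof. by rewrite conj_phase -phaseD subrr phase0. Qed.

Lemma qroot_conjC l m : w l * conjq (w m) = conjq (w m) * w l.
Proof. by rewrite conj_phase /qroot -!phaseD addrC. Qed.

(** [cos (2 x) = 1 - 2 sin x ^ 2] is less than 1 for [x] strictly between 0
    and [pi]. *)
Lemma qroot_neq1 d : (0 < d < n)%N -> w d != 1.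
Proof.
case/andP => d0 dn; apply/eqP => /(congr1 (@qre R)) /=.
case: nuP => r0 _; rewrite r0 !mul0r !mulr0 !subr0.
pose x : R := pi * d%:R / n%:R.
have -> : 2 * pi * d%:R / n%:R = x *+ 2 by rewrite -[RHS]mulr_natl /x !mulrA.
rewrite cos_mulr2n cos2sin2 => cos1.
have : 0 < sin x.
  have ngt0 : 0 < n%:R :> R by rewrite ltr0n.
  apply: sin_gt0_pi; rewrite /x divr_gt0 ?mulr_gt0 ?pi_gt0 ?ltr0n //=.
  by rewrite ltr_pdivrMr // ltr_pM2l ?pi_gt0 // ltr_nat.
by move=> s0; have := exprn_gt0 2 s0; lra.
Qed.

(** Two equal roots with distinct exponents below [n] would have quotient 1 at a
    nonzero exponent below [n]. *)
Lemma qroot_inj : {in [pred m | (m < n)%N] &, injective w}.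
Proof.
suff winj l m : (l <= m)%N -> (m < n)%N -> w l = w m -> l = m.
  move=> l m; rewrite !inE => ln mn wlm.
  by case: (leqP l m) => [|/ltnW] lm; [|apply/esym]; apply: winj.
move=> lm mn wlm.
have wd1 : w (m - l) = 1.
  rewrite -[LHS]mulr1 -(mul_qroot_conj l) mulrA -qrootD subnK //.
  by rewrite wlm mul_qroot_conj.
apply/eqP; rewrite eqn_leq lm leqNgt -subn_gt0; apply/negP => ml0.
have := @qroot_neq1 (m - l); rewrite ml0 (leq_ltn_trans (leq_subr _ _) mn).
by rewrite wd1 eqxx => /(_ isT).
Qed.

(** A geometric sum: the ratio is an [n]-th root of unity, different from 1
    unless the two indices agree. *)
Lemma qroot_orthogonal (a b : 'I_n) :
  \sum_(t < n) w (t * a) * conjq (w (t * b)) = realq (n%:R * (a == b)%:R).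
Proof.
have [->|ab] := eqVneq a b.
  under eq_bigr do rewrite mul_qroot_conj.
  by rewrite sumr_const card_ord mulr1 rmorph_nat.
rewrite mulr0 raddf0; pose z := w a * conjq (w b).
have conjX x m : conjq (x ^+ m) = conjq x ^+ m :> H.
  elim: m => [|m IHm]; first exact: conjq_realq.
  by rewrite exprS conjqM IHm exprSr.
have zE (t : nat) : w (t * a) * conjq (w (t * b)) = z ^+ t.
  by rewrite !qrootM conjX exprMn_comm //; apply: qroot_conjC.
under eq_bigr do rewrite zE.
(* The sum is annihilated by [z - 1], since [z ^+ n = 1]. *)
apply: (@mulq_eq0 _ (z - 1)).
  rewrite -subrX1 -zE ![(n * _)%N]mulnC !qrootM !qroot_period !expr1n mul1r.
  by rewrite -[1]/(realq 1) conjq_realq subrr.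
rewrite subr_eq0; apply: contra ab => /eqP z1; apply/eqP/val_inj.
apply: qroot_inj; rewrite ?inE ?ltn_ord //.
by rewrite -[LHS]mulr1 -(mul_qroot_conj b) qroot_conjC mulrA -/z z1 mul1r.
Qed.

End FixedUnit.
End RootsOfUnity.

Section SliceTransform.
Variable R : realType.
Local Notation H := (quat R).
Variable n : nat.
Hypothesis n0 : (0 < n)%N.
Local Notation w nu := (qroot nu n).
Implicit Types (mu nu u x : H).

(** Unnormalised transform of a family of matrices, acting entrywise from the
    left; at [nu = mu] it is the transform [qdft] of a tensor ([qdftE]).  The
    axis [nu] is a parameter because the product of tensors involves four axes. *)
Definition dft (nu : H) m p (Z : 'I_n -> 'M[H]_(m, p)) (q : 'I_n) : 'M[H]_(m, p) :=
  \sum_(t < n) w nu (q * t) *: Z t.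

Lemma eq_dft nu m p (Z Z' : 'I_n -> 'M[H]_(m, p)) : Z =1 Z' -> dft nu Z =1 dft nu Z'.
Proof. by move=> ZZ' q; apply: eq_bigr => t _; rewrite ZZ'. Qed.

Lemma dftD nu m p (Z Z' : 'I_n -> 'M[H]_(m, p)) q :
  dft nu (fun t => Z t + Z' t) q = dft nu Z q + dft nu Z' q.
Proof. by rewrite /dft -big_split; apply: eq_bigr => t _; rewrite scalerDr. Qed.

Lemma dftB nu m p (Z Z' : 'I_n -> 'M[H]_(m, p)) q :
  dft nu (fun t => Z t - Z' t) q = dft nu Z q - dft nu Z' q.
Proof. by rewrite /dft -sumrB; apply: eq_bigr => t _; rewrite scalerBr. Qed.

Lemma dft_twist nu nu' u m p (Z : 'I_n -> 'M[H]_(m, p)) q :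
  nu * u = u * nu' -> dft nu (fun t => u *: Z t) q = u *: dft nu' Z q.
Proof.
move=> uP; rewrite /dft scaler_sumr; apply: eq_bigr => t _.
by rewrite !scalerA /qroot (phase_twist _ uP).
Qed.

Lemma dft_scalemxr nu m p (Z : 'I_n -> 'M[H]_(m, p)) x q :
  dft nu (fun t => scalemxr (Z t) x) q = scalemxr (dft nu Z q) x.
Proof.
apply/matrixP => i j; rewrite !mxE !summxE mulr_suml; apply: eq_bigr => t _.
by rewrite !mxE mulrA.
Qed.

Lemma dft_mxsub nu m p m' p' (f : 'I_m' -> 'I_m) (g : 'I_p' -> 'I_p)
    (Z : 'I_n -> 'M[H]_(m, p)) q :
  dft nu (fun t => mxsub f g (Z t)) q = mxsub f g (dft nu Z q).
Proof.
by apply/matrixP => i j; rewrite mxE !summxE; apply: eq_bigr => t _; rewrite !mxE.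
Qed.

(** The factor [sqrt n] in [qdft] cancels the normalisation of [qdftmx]. *)
Lemma qdftE mu m p (A : tensor H m p n) (q : 'I_n) : qdft mu A q = dft mu A q.
Proof.
apply/matrixP => i j; rewrite ffunE !mxE summxE mulr_sumr; apply: eq_bigr => t _.
rewrite !mxE !mulrA -rmorphM /= divff ?rmorph1 ?mul1r //.
by rewrite gt_eqF // sqrtr_gt0 ltr0n.
Qed.

Lemma TmxE nu nu' (p s : 'I_n) :
  Tmx nu nu' n p s =
  \sum_(t < n) realq n%:R^-1 * (conjq (w nu (t * p)) * w nu' (t * s)).
Proof.
have pull a (x y : H) : x * realq a * (realq a * y) = realq (a * a) * (x * y).
  by rewrite -realq_comm rmorphM -!mulrA; congr (_ * _); rewrite !mulrA -realq_comm.
rewrite mxE; apply: eq_bigr => t _; rewrite !mxE conjqM conjq_realq pull.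
by rewrite -invfM -expr2 sqr_sqrtr ?ler0n.
Qed.

Lemma adjq_Tmx nu nu' : adjq (Tmx nu nu' n) = Tmx nu' nu n.
Proof. by rewrite adjqM adjqK. Qed.

(** [Tmx nu nu'] is the change of transform: the inverse transform along [nu]
    after the transform along [nu']. *)
Lemma dft_Tmx nu nu' m p (Z : 'I_n -> 'M[H]_(m, p)) q : unit_pure nu ->
  dft nu (fun t => \sum_s Tmx nu nu' n t s *: Z s) q = dft nu' Z q.
Proof.
move=> nuP; have nR0 : n%:R != 0 :> R by rewrite pnatr_eq0 -lt0n.
transitivity (\sum_s (\sum_(t < n) w nu (q * t) * Tmx nu nu' n t s) *: Z s).
  rewrite /dft; under eq_bigr do rewrite scaler_sumr.
  rewrite exchange_big; apply: eq_bigr => s _; rewrite scaler_suml.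
  by apply: eq_bigr => t _; rewrite scalerA.
apply: eq_bigr => s _; congr (_ *: _).
transitivity (\sum_(r < n) realq n%:R^-1 *
    (\sum_(t < n) w nu (t * q) * conjq (w nu (t * r))) * w nu' (r * s)).
  under eq_bigr do rewrite TmxE mulr_sumr.
  rewrite exchange_big; apply: eq_bigr => r _; rewrite mulr_sumr mulr_suml.
  apply: eq_bigr => t _; rewrite (mulnC q) (mulnC t r).
  by rewrite mulrA -realq_comm !mulrA.
rewrite (bigD1 q) //= [X in _ + X]big1 ?addr0 => [|r rq].
    by rewrite qroot_orthogonal // eqxx mulr1 -rmorphM /= mulVf // mul1r.
by rewrite qroot_orthogonal // eq_sym (negPf rq) mulr0 raddf0 mulr0 mul0r.
Qed.

(** Expanding the squared norms as [conjq x * x] leaves, between [conjq (z s)]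
    and [z t], an orthogonality sum, which vanishes unless [s = t]. *)
Lemma parseval_entry nu (z : 'I_n -> H) : unit_pure nu ->
  \sum_(q < n) normq2 (\sum_(t < n) w nu (q * t) * z t) = n%:R * \sum_t normq2 (z t).
Proof.
move=> nuP.
suff: realq (\sum_(q < n) normq2 (\sum_(t < n) w nu (q * t) * z t)) =
      realq (n%:R * \sum_t normq2 (z t)) by case.
rewrite rmorph_sum rmorphM rmorph_sum /=.
transitivity (\sum_(s < n) \sum_(t < n)
    conjq (z s) * (\sum_(q < n) w nu (q * t) * conjq (w nu (q * s))) * z t).
  under eq_bigr do rewrite -mul_conjq raddf_sum mulr_suml.
  rewrite exchange_big; apply: eq_bigr => s _ /=.
  under eq_bigr do rewrite mulr_sumr.
  rewrite exchange_big; apply: eq_bigr => t _ /=.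
  rewrite mulr_sumr mulr_suml; apply: eq_bigr => q _.
  by rewrite conjqM qroot_conjC // !mulrA.
rewrite mulr_sumr; apply: eq_bigr => s _.
rewrite (bigD1 s) //= [X in _ + X]big1 ?addr0 => [|t ts].
  by rewrite qroot_orthogonal // eqxx mulr1 -realq_comm -mulrA mul_conjq.
by rewrite qroot_orthogonal // (negPf ts) mulr0 raddf0 mulr0 mul0r.
Qed.

Lemma parseval nu m p (Z : 'I_n -> 'M[H]_(m, p)) : unit_pure nu ->
  \sum_q frob2 (dft nu Z q) = n%:R * \sum_t frob2 (Z t).
Proof.
move=> nuP; rewrite /frob2 exchange_big [in RHS]exchange_big mulr_sumr.
apply: eq_bigr => i _ /=; rewrite exchange_big [in RHS]exchange_big mulr_sumr.
apply: eq_bigr => j _ /=; rewrite -(parseval_entry _ nuP).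
apply: eq_bigr => q _; congr normq2; rewrite summxE.
by apply: eq_bigr => t _; rewrite mxE.
Qed.

Lemma dft_inj nu m p (Z Z' : 'I_n -> 'M[H]_(m, p)) : unit_pure nu ->
  dft nu Z =1 dft nu Z' -> Z =1 Z'.
Proof.
move=> nuP ZZ' t; apply/eqP; rewrite -subr_eq0; apply/eqP/frob2_eq0.
have := parseval (fun t => Z t - Z' t) nuP.
rewrite big1 => [/esym/eqP|q _]; last first.
  by rewrite dftB ZZ' subrr frob2_0.
rewrite mulf_eq0 pnatr_eq0 gtn_eqF //=.
by move=> /eqP/psumr_eq0P -> // ? _; apply: frob2_ge0.
Qed.

End SliceTransform.

(** * Transforms of tensor products and adjoints *)

Section TensorProduct.
Variable R : realType.
Local Notation H := (quat R).
Variable n : nat.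
Hypothesis n0 : (0 < n)%N.
Implicit Types (mu nu u x : H).
Local Notation w nu := (qroot nu n).

Definition realmx m p (M : 'M[R]_(m, p)) : 'M[H]_(m, p) := map_mx (@realq R) M.

Lemma quat_decomp x :
  x = realq (qre x) + iq * realq (qi x) + jq * realq (qj x) + kq * realq (qk x).
Proof. by apply: quatP => /=; ring. Qed.

Lemma tensor_decomp m p (A : tensor H m p n) t :
  A t = realmx (tmap (@qre R) A t) + iq *: realmx (tmap (@qi R) A t)
        + jq *: realmx (tmap (@qj R) A t) + kq *: realmx (tmap (@qk R) A t).
Proof. by apply/matrixP => i j; rewrite !ffunE !mxE -quat_decomp. Qed.

Section Twists.
Variable mu : H.
Hypothesis muP : unit_pure mu.

Lemma unit_pure_mui : unit_pure (mui mu).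
Proof. by case: muP => _ n1; split; rewrite //= ?sqrrN. Qed.
Lemma unit_pure_muj : unit_pure (muj mu).
Proof. by case: muP => _ n1; split; rewrite //= ?sqrrN. Qed.
Lemma unit_pure_muk : unit_pure (muk mu).
Proof. by case: muP => _ n1; split; rewrite //= ?sqrrN. Qed.

Lemma mui_twist : mu * iq = iq * mui mu.
Proof. by case: muP => r0 _; apply: quatP => /=; rewrite r0; ring. Qed.
Lemma muj_twist : mu * jq = jq * muj mu.
Proof. by case: muP => r0 _; apply: quatP => /=; rewrite r0; ring. Qed.
Lemma muk_twist : mu * kq = kq * muk mu.
Proof. by case: muP => r0 _; apply: quatP => /=; rewrite r0; ring. Qed.

(** The units [iq], [jq], [kq] leave the transform along [mu], each at the price
    of its own axis. *)
Lemma dft_components m p (Z0 Z1 Z2 Z3 : 'I_n -> 'M[H]_(m, p)) q :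
  dft mu (fun t => Z0 t + iq *: Z1 t + jq *: Z2 t + kq *: Z3 t) q =
  dft mu Z0 q + iq *: dft (mui mu) Z1 q + jq *: dft (muj mu) Z2 q
    + kq *: dft (muk mu) Z3 q.
Proof.
rewrite !dftD (dft_twist _ _ mui_twist) (dft_twist _ _ muj_twist).
by rewrite (dft_twist _ _ muk_twist).
Qed.

Lemma dft_tensor m p (A : tensor H m p n) q :
  dft mu A q = dft mu (fun t => realmx (tmap (@qre R) A t)) q
    + iq *: dft (mui mu) (fun t => realmx (tmap (@qi R) A t)) q
    + jq *: dft (muj mu) (fun t => realmx (tmap (@qj R) A t)) q
    + kq *: dft (muk mu) (fun t => realmx (tmap (@qk R) A t)) q.
Proof. by rewrite (eq_dft mu (tensor_decomp A)) dft_components. Qed.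

End Twists.

Lemma realmx_scale m p r (C : 'M[R]_(m, p)) x (Z : 'M[H]_(p, r)) :
  realmx C *m (x *: Z) = x *: (realmx C *m Z).
Proof.
apply/matrixP => i j; rewrite !mxE mulr_sumr; apply: eq_bigr => l _.
by rewrite !mxE !mulrA realq_comm.
Qed.

Lemma ordsub_inj (s : 'I_n) : injective (fun p : 'I_n => ordsub p s).
Proof.
move=> p p' /(congr1 val) /= /eqP; rewrite eqn_modDr.
by rewrite !modn_small ?ltn_ord // => /eqP/val_inj.
Qed.

Lemma qroot_ordsub nu (q p s : 'I_n) : unit_pure nu ->
  w nu (q * p) = w nu (q * ordsub p s) * w nu (q * s).
Proof.
move=> nuP; rewrite -qrootD // -mulnDr -(qroot_mod nuP n0 (q * (_ + _))).
rewrite -modnMmr /= modnDml -addnA subnK ?modnDr ?modnMmr ?qroot_mod //.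
exact: ltnW.
Qed.

Lemma qroot_ordopp nu (q p : 'I_n) : unit_pure nu ->
  w nu (q * ordopp p) = conjq (w nu (q * p)).
Proof.
move=> nuP; rewrite -[LHS]mulr1 -(mul_qroot_conj nuP n (q * p)) mulrA -qrootD //.
rewrite -mulnDr -(qroot_mod nuP n0 (q * (_ + _))) -modnMmr /= modnDml subnK.
  by rewrite modnn muln0 mod0n qroot0 // mul1r.
exact: ltnW.
Qed.

(** Convolution theorem.  The coefficients [C] have to be real: only then do
    they commute with the root of unity that is attached to [Z]. *)
Lemma dft_conv nu m p r (C : 'I_n -> 'M[R]_(m, p)) (Z : 'I_n -> 'M[H]_(p, r)) q :
    unit_pure nu ->
  dft nu (fun t => \sum_s realmx (C (ordsub t s)) *m Z s) q =
  dft nu (fun t => realmx (C t)) q *m dft nu Z q.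
Proof.
move=> nuP; rewrite /dft.
under eq_bigr do rewrite scaler_sumr.
rewrite exchange_big [RHS]mulmx_sumr; apply: eq_bigr => s _ /=.
rewrite mulmx_suml [RHS](reindex_inj (@ordsub_inj s)); apply: eq_bigr => t _ /=.
by rewrite -scalemxAl realmx_scale scalerA -qroot_ordsub.
Qed.

Lemma ordoppK : involutive (@ordopp n).
Proof.
move=> p; apply: val_inj => /=; have pn := ltn_ord p.
have [p0|p0] := posnP p; first by rewrite p0 subn0 modnn subn0 modnn.
rewrite (@modn_small (n - p)); last by rewrite ltn_subrL p0.
by rewrite subKn ?modn_small // ltnW.
Qed.

(** Reversal of the slices conjugates the roots of unity, and conjugation of
    a real multiple of a root only affects the root. *)
Lemma dft_ttr nu m p (C : tensor R m p n) q : unit_pure nu ->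
  dft nu (fun t => realmx (ttr C t)) q = adjq (dft nu (fun t => realmx (C t)) q).
Proof.
move=> nuP; rewrite /dft (reindex_inj (inv_inj ordoppK)).
apply/matrixP => i j; rewrite !mxE !summxE raddf_sum; apply: eq_bigr => t _.
by rewrite qroot_ordopp // ffunE ordoppK /= !mxE conjqM conjq_realq realq_comm.
Qed.

Lemma sum_mxtens m p (F : 'I_(m * p) -> H) :
  \sum_c F c = \sum_(s < m) \sum_(l < p) F (mxtens_index (s, l)).
Proof.
rewrite pair_bigA (reindex (@mxtens_index m p)) /=.
  by apply: eq_bigr => -[].
by exists (@mxtens_unindex m p) => i _; rewrite ?mxtens_indexK ?mxtens_unindexK.
Qed.

Lemma unfoldK m p : cancel (@unfold H m p n) (@fold H m p n).
Proof.
by move=> A; apply/ffunP => t; apply/matrixP => i j; rewrite ffunE !mxE mxtens_indexK.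
Qed.

Lemma unfoldD m p (F G : 'I_n -> 'M[H]_(m, p)) :
  unfold [ffun t => F t] + unfold [ffun t => G t] = unfold [ffun t => F t + G t].
Proof. by apply/matrixP => i j; rewrite !mxE !ffunE mxE. Qed.

Lemma unfoldB m p (F G : 'I_n -> 'M[H]_(m, p)) :
  unfold [ffun t => F t] - unfold [ffun t => G t] = unfold [ffun t => F t - G t].
Proof. by apply/matrixP => i j; rewrite !mxE !ffunE !mxE. Qed.

Lemma circ_unfold m p r (C : tensor R m p n) (Z : tensor H p r n) :
  map_mx (@realq R) (circ C) *m unfold Z =
  unfold [ffun t => \sum_s realmx (C (ordsub t s)) *m Z s].
Proof.
apply/matrixP => c j; rewrite [LHS]mxE sum_mxtens [RHS]mxE ffunE summxE.
apply: eq_bigr => s _; rewrite [RHS]mxE; apply: eq_bigr => l _.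
by rewrite !mxE mxtens_indexK.
Qed.

Lemma tens_unfold m p (T : 'M[H]_n) (Z : tensor H m p n) :
  (T *t 1%:M) *m unfold Z = unfold [ffun t => \sum_s T t s *: Z s].
Proof.
apply/matrixP => c j; case: (mxtens_indexP c) => t i.
rewrite [LHS]mxE sum_mxtens [RHS]mxE mxtens_indexK ffunE summxE.
apply: eq_bigr => s _; rewrite (bigD1 i) //= big1 => [|l li].
  by rewrite tensmxE !mxE !mxtens_indexK eqxx mulr1 addr0.
by rewrite tensmxE !mxE eq_sym (negPf li) mulr0 mul0r.
Qed.

(** The shape of the three imaginary terms of the product of tensors. *)
Lemma twisted_circ_unfold u m p r (C : tensor R m p n) (T : 'M[H]_n)
    (Z : tensor H p r n) :
  (u *: (map_mx (@realq R) (circ C) *m (T *t 1%:M))) *m unfold Z =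
  unfold [ffun t => u *: \sum_s realmx (C (ordsub t s)) *m \sum_s' T s s' *: Z s'].
Proof.
rewrite -scalemxAl -mulmxA tens_unfold circ_unfold.
apply/matrixP => i j; rewrite !mxE !ffunE !mxE; congr (_ * _).
rewrite !summxE; apply: eq_bigr => s _.
by rewrite ffunE.
Qed.

Lemma gqt_mulE mu m p r (A : tensor H m p n) (B : tensor H p r n) t :
  let conv (C : tensor R m p n) (Z : 'I_n -> 'M[H]_(p, r)) :=
    \sum_s realmx (C (ordsub t s)) *m Z s in
  let twist nu s := \sum_s' Tmx nu mu n s s' *: B s' in
  gqt_mul mu A B t =
    conv (tmap (@qre R) A) B
    + iq *: conv (tmap (@qi R) A) (twist (mui mu))
    + jq *: conv (tmap (@qj R) A) (twist (muj mu))
    + kq *: conv (tmap (@qk R) A) (twist (muk mu)).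
Proof.
move=> conv twist; rewrite /gqt_mul 3!mulmxDl.
rewrite [X in _ + X]twisted_circ_unfold.
rewrite [X in _ + X + _]twisted_circ_unfold.
rewrite [X in _ + X + _ + _]twisted_circ_unfold.
rewrite [X in X + _ + _ + _]circ_unfold.
by rewrite 3!unfoldD unfoldK ffunE.
Qed.

Lemma dft_twisted_conv nu nu' m p r (C : 'I_n -> 'M[R]_(m, p))
    (Z : 'I_n -> 'M[H]_(p, r)) q : unit_pure nu ->
  dft nu (fun t => \sum_s realmx (C (ordsub t s)) *m
                     \sum_s' Tmx nu nu' n s s' *: Z s') q =
  dft nu (fun t => realmx (C t)) q *m dft nu' Z q.
Proof. by move=> nuP; rewrite (dft_conv _ _ _ nuP) (dft_Tmx n0 _ _ _ nuP). Qed.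

Lemma mulmx_components m p r (M0 M1 M2 M3 : 'M[H]_(m, p)) (N : 'M[H]_(p, r)) :
  (M0 + iq *: M1 + jq *: M2 + kq *: M3) *m N =
  M0 *m N + iq *: (M1 *m N) + jq *: (M2 *m N) + kq *: (M3 *m N).
Proof. by rewrite 3!mulmxDl !scalemxAl. Qed.

(** Each imaginary part of [A] is transformed along the axis of its unit; the
    matrix [Tmx] in the product makes the corresponding transform of [B] the one
    along [mu], so that [dft mu B q] factors out on the right. *)
Lemma dft_gqt_mul mu m p r (A : tensor H m p n) (B : tensor H p r n) q :
  unit_pure mu -> dft mu (gqt_mul mu A B) q = dft mu A q *m dft mu B q.
Proof.
move=> muP; rewrite (eq_dft _ (gqt_mulE _ _ _)) (dft_components muP).
rewrite [X in X + _ + _ + _](dft_conv _ _ _ muP).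
rewrite [X in _ + _ *: X + _ + _](dft_twisted_conv _ _ _ _ (unit_pure_mui muP)).
rewrite [X in _ + _ *: X + _](dft_twisted_conv _ _ _ _ (unit_pure_muj muP)).
rewrite [X in _ + _ *: X](dft_twisted_conv _ _ _ _ (unit_pure_muk muP)).
by rewrite (dft_tensor muP A) [RHS]mulmx_components.
Qed.

Lemma map_unfold m p (C : tensor R m p n) :
  map_mx (@realq R) (unfold C) = unfold [ffun t => realmx (C t)].
Proof. by apply/matrixP => i j; rewrite !mxE ffunE mxE. Qed.

(** The shape of the three imaginary terms of the conjugate transpose. *)
Lemma twisted_unfold mu nu x m p (C : tensor R m p n) :
  scalemxr ((adjq (Tmx nu mu n) *t 1%:M) *m map_mx (@realq R) (unfold C)) x =
  unfold [ffun t => scalemxr (\sum_s Tmx mu nu n t s *: realmx (C s)) x].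
Proof.
rewrite map_unfold adjq_Tmx tens_unfold.
apply/matrixP => i j; rewrite [LHS]mxE [X in X * _]mxE [RHS]mxE !ffunE [RHS]mxE.
by congr (_ * _); rewrite !summxE; apply: eq_bigr => s _; rewrite ffunE.
Qed.

Lemma gqt_adjE mu m p (A : tensor H m p n) t :
  let part f nu := scalemxr (\sum_s Tmx mu nu n t s *: realmx (ttr (tmap f A) s)) in
  gqt_adj mu A t =
    realmx (ttr (tmap (@qre R) A) t) - part (@qi R) (mui mu) iq
    - part (@qj R) (muj mu) jq - part (@qk R) (muk mu) kq.
Proof.
move=> part; rewrite /gqt_adj.
rewrite [X in _ - X]twisted_unfold.
rewrite [X in _ - X + _]twisted_unfold.
rewrite [X in _ - X + _ + _]twisted_unfold.
rewrite [X in X + _ + _ + _]map_unfold.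
by rewrite 3!unfoldB unfoldK ffunE.
Qed.

Lemma dft_twisted_ttr mu nu x m p (C : tensor R m p n) q :
    unit_pure mu -> unit_pure nu ->
  dft mu (fun t => scalemxr (\sum_s Tmx mu nu n t s *: realmx (ttr C s)) x) q =
  scalemxr (adjq (dft nu (fun t => realmx (C t)) q)) x.
Proof.
by move=> muP nuP; rewrite dft_scalemxr (dft_Tmx n0 _ _ _ muP) (dft_ttr _ _ nuP).
Qed.

Lemma adjq_components m p (M0 M1 M2 M3 : 'M[H]_(m, p)) :
  adjq (M0 + iq *: M1 + jq *: M2 + kq *: M3) =
  adjq M0 - scalemxr (adjq M1) iq - scalemxr (adjq M2) jq - scalemxr (adjq M3) kq.
Proof.
by apply/matrixP => i j; rewrite !mxE; apply: quatP => /=; ring.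
Qed.

(** The units now stand on the right, where they commute with the transform;
    [Tmx mu nu] makes the transform that acts on the part of [A] along the unit
    the one along [nu], as in the decomposition of [dft mu A q]. *)
Lemma dft_gqt_adj mu m p (A : tensor H m p n) q :
  unit_pure mu -> dft mu (gqt_adj mu A) q = adjq (dft mu A q).
Proof.
move=> muP; rewrite (eq_dft _ (gqt_adjE _ _)) 3!dftB (dft_ttr _ _ muP).
rewrite [X in _ - X](dft_twisted_ttr _ _ _ muP (unit_pure_muk muP)).
rewrite [X in _ - X + _](dft_twisted_ttr _ _ _ muP (unit_pure_muj muP)).
rewrite [X in _ - X + _ + _](dft_twisted_ttr _ _ _ muP (unit_pure_mui muP)).
by rewrite (dft_tensor muP A) [RHS]adjq_components.
Qed.

End TensorProduct.

(** * The truncated decomposition *)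

Section Truncation.
Variable R : realType.
Local Notation H := (quat R).

Lemma adjq_colsub m n p (g : 'I_p -> 'I_n) (V : 'M[H]_(m, n)) :
  adjq (colsub g V) = rowsub g (adjq V).
Proof. by apply/matrixP => i j; rewrite !mxE. Qed.

Lemma colsub1_rowsub1 n k (f : 'I_k -> 'I_n) :
    (forall i, f i = i :> nat) -> (k <= n)%N ->
  colsub f 1%:M *m rowsub f 1%:M = truncproj R n k.
Proof.
move=> fE kn; apply/matrixP => a b; rewrite mxE.
have term i : (colsub f 1%:M : 'M[H]_(n, k)) a i *
    (rowsub f 1%:M : 'M[H]_(k, n)) i b =
    ((a == f i) && (a == b))%:R.
  rewrite !mxE; have [->|] := eqVneq a (f i); rewrite ?mul1r ?mul0r //.
under eq_bigr do rewrite term.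
rewrite !mxE; have [ab|_] := eqVneq a b; last first.
  by rewrite big1 // => i _; rewrite andbF.
rewrite mulr1n; have [ak|ka] := ltnP a k.
  rewrite (bigD1 (Ordinal ak)) //= [X in _ + X]big1 ?addr0 => [|i ia].
    by rewrite andbT (_ : a == _) //; apply/eqP/val_inj; rewrite /= fE.
  rewrite andbT (_ : a == _ = false) //; apply/negbTE; apply: contra ia => /eqP aE.
  by apply/eqP/val_inj; rewrite /= aE fE.
rewrite big1 ?raddf0 // => i _; rewrite (_ : a == _ = false) //.
by apply/eqP => aE; move: ka; rewrite aE fE leqNgt ltn_ord.
Qed.

Lemma truncproj_comm m n k (S : 'M[H]_(m, n)) :
    (forall (i : 'I_m) (j : 'I_n), i <> j :> nat -> S i j = 0) ->
  S *m truncproj R n k = truncproj R m k *m S.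
Proof.
move=> Sd; rewrite mul_diag_mx mul_mx_diag; apply/matrixP => i j; rewrite !mxE.
have [ij|/eqP ij] := eqVneq (i : nat) j; last by rewrite Sd // mulr0 mul0r.
by rewrite ij realq_comm.
Qed.

(** The selection of columns and of the corner are products with selection
    matrices, which recombine into [truncproj]; the diagonal [S] intertwines its
    versions of the two sizes, and their two occurrences merge by idempotence. *)
Lemma mxsub_truncproj m n k (f : 'I_k -> 'I_m) (g : 'I_k -> 'I_n)
    (U : 'M[H]_m) (S : 'M[H]_(m, n)) (V : 'M[H]_n) :
    (forall i, f i = i :> nat) -> (forall i, g i = i :> nat) ->
    (k <= m)%N -> (k <= n)%N ->
    (forall (i : 'I_m) (j : 'I_n), i <> j :> nat -> S i j = 0) ->
  colsub f U *m mxsub f g S *m adjq (colsub g V) =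
  U *m (truncproj R m k *m S) *m adjq V.
Proof.
move=> fE gE km kn Sd; rewrite adjq_colsub.
have -> : colsub f U = U *m colsub f 1%:M by rewrite mulmx_colsub mulmx1.
have -> : rowsub g (adjq V) = rowsub g 1%:M *m adjq V.
  by rewrite mul_rowsub_mx mul1mx.
have -> : mxsub f g S = rowsub f 1%:M *m S *m colsub g 1%:M.
  rewrite mul_rowsub_mx mul1mx mulmx_colsub mulmx1.
  by apply/matrixP => i j; rewrite !mxE.
set C := colsub f 1%:M; set D := rowsub f 1%:M.
set C' := colsub g 1%:M; set D' := rowsub g 1%:M.
have -> : U *m C *m (D *m S *m C') *m (D' *m adjq V) =
    U *m (C *m D) *m S *m (C' *m D') *m adjq V by rewrite !mulmxA.
rewrite (colsub1_rowsub1 fE km) (colsub1_rowsub1 gE kn).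
rewrite -(mulmxA U _ S) -(mulmxA U (_ *m S)) -(mulmxA _ S) (truncproj_comm _ Sd).
by rewrite (mulmxA _ _ S) (truncproj_ortho R m k).2.
Qed.

(** A product with a diagonal middle factor is a sum of matrices of rank 1. *)
Lemma sum_outer m n k (X : 'M[H]_(m, k)) (D : 'M[H]_k) (Y : 'M[H]_(n, k)) :
    (forall i j : 'I_k, i <> j -> D i j = 0) ->
  \sum_i col i X *m (const_mx (D i i) : 'M_1) *m adjq (col i Y) =
  X *m D *m adjq Y.
Proof.
move=> Dd; apply/matrixP => a b; rewrite summxE [RHS]mxE; apply: eq_bigr => i _.
rewrite mxE big_ord1 mxE big_ord1 [in RHS]mxE (bigD1 i) //=.
rewrite [X in _ + X]big1 => [|l /eqP li].
  by rewrite addr0 !mxE.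
by rewrite Dd // mulr0.
Qed.

Variable n3 : nat.
Hypothesis n30 : (0 < n3)%N.

Lemma dft_tlateral mu m n (U : tensor H m n n3) j q :
  dft mu (tlateral U j) q = col j (dft mu U q).
Proof.
apply/matrixP => a b; rewrite mxE !summxE; apply: eq_bigr => t _.
by rewrite ffunE !mxE.
Qed.

Lemma dft_ttube mu m n (S : tensor H m n n3) i j q :
  dft mu (ttube S i j) q = const_mx (dft mu S q i j).
Proof.
apply/matrixP => a b; rewrite mxE !summxE; apply: eq_bigr => t _.
by rewrite ffunE !mxE.
Qed.

Definition tsub m n m' n' (f : 'I_m' -> 'I_m) (g : 'I_n' -> 'I_n)
    (A : tensor H m n n3) : tensor H m' n' n3 := [ffun t => mxsub f g (A t)].

Lemma dft_tsub mu m n m' n' (f : 'I_m' -> 'I_m) (g : 'I_n' -> 'I_n)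
    (A : tensor H m n n3) q : dft mu (tsub f g A) q = mxsub f g (dft mu A q).
Proof. by rewrite -dft_mxsub; apply: eq_dft => t; rewrite ffunE. Qed.

Lemma dft_sum mu m n k (A : 'I_k -> tensor H m n n3) q :
  dft mu (\sum_i A i) q = \sum_i dft mu (A i) q.
Proof.
rewrite /dft exchange_big; apply: eq_bigr => t _ /=.
by rewrite sum_ffunE scaler_sumr.
Qed.

Section Truncated.
Variables (mu : H) (n1 n2 k : nat) (hk : (k < minn n1 n2)%N).
Variables (U : tensor H n1 n1 n3) (S : tensor H n1 n2 n3) (V : tensor H n2 n2 n3).
Hypothesis muP : unit_pure mu.
Hypothesis Sd : forall q (i : 'I_n1) (j : 'I_n2), i <> j :> nat -> dft mu S q i j = 0.
Local Notation f := (widen_ord (ltn_minn_leql hk)).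
Local Notation g := (widen_ord (ltn_minn_leqr hk)).

Lemma dft_gqt_trunc q :
  dft mu (gqt_trunc mu U S V hk) q =
  colsub f (dft mu U q) *m mxsub f g (dft mu S q) *m adjq (colsub g (dft mu V q)).
Proof.
rewrite dft_sum -sum_outer => [|i j ij]; last first.
  by rewrite mxE Sd // => ij'; apply/ij/val_inj.
apply: eq_bigr => i _; rewrite 2!col_colsub [X in const_mx X]mxE.
rewrite -(dft_tlateral mu U) -(dft_tlateral mu V) -(dft_ttube mu S).
by rewrite -(dft_gqt_adj n30 _ _ muP) -2!(dft_gqt_mul n30 _ _ _ muP).
Qed.

(** The factors are recognised after the transform, where selection of columns
    is visible on each slice, and injectivity brings the identity back. *)
Lemma gqt_trunc_factorizable : gqt_factorizable mu k (gqt_trunc mu U S V hk).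
Proof.
exists (gqt_mul mu (tsub id f U) (tsub f g S)), (gqt_adj mu (tsub id g V)).
apply/ffunP; apply: (dft_inj n30 muP) => q.
by rewrite dft_gqt_trunc !dft_gqt_mul // dft_gqt_adj // !dft_tsub.
Qed.

End Truncated.

Lemma tnorm_le_dft mu m n (A B : tensor H m n n3) : unit_pure mu ->
    (forall q, frob2 (dft mu A q) <= frob2 (dft mu B q)) ->
  tnorm A <= tnorm B.
Proof.
move=> muP AB; rewrite /tnorm ler_wsqrtr //.
rewrite -(ler_pM2l (_ : 0 < n3%:R)) ?ltr0n //.
rewrite -[leLHS](parseval n30 A muP) -[leRHS](parseval n30 B muP).
by apply: ler_sum => q _.
Qed.

Definition slice_svd m n (A : 'M[H]_(m, n)) (U : 'M[H]_m) (S : 'M[H]_(m, n))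
    (V : 'M[H]_n) : Prop :=
  [/\ A = U *m S *m adjq V, unitaryq U, unitaryq V & singular_value_mx S].

Lemma gqt_svd_slices mu m n (A : tensor H m n n3) (U : tensor H m m n3)
    (S : tensor H m n n3) (V : tensor H n n n3) : is_gqt_svd mu A U S V ->
  forall q, slice_svd (dft mu A q) (dft mu U q) (dft mu S q) (dft mu V q).
Proof.
case=> _ hat q.
have transfer A1 A2 U1 U2 S1 S2 V1 V2 :
    A1 = A2 -> U1 = U2 -> S1 = S2 -> V1 = V2 ->
  @slice_svd m n A1 U1 S1 V1 -> @slice_svd m n A2 U2 S2 V2.
  by move=> -> -> -> ->.
by apply: transfer (hat q); apply: qdftE.
Qed.

End Truncation.

Theorem theorem3p6 (R : realType) (mu : quat R) (hmu : unit_pure mu)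
    (n1 n2 n3 : nat) (hn1 : (0 < n1)%N) (hn2 : (0 < n2)%N) (hn3 : (0 < n3)%N)
    (A : tensor (quat R) n1 n2 n3)
    (U : tensor (quat R) n1 n1 n3) (S : tensor (quat R) n1 n2 n3)
    (V : tensor (quat R) n2 n2 n3) (hsvd : is_gqt_svd mu A U S V)
    (k : nat) (hk0 : (0 < k)%N) (hk : (k < minn n1 n2)%N) :
  argmin (fun C : tensor (quat R) n1 n2 n3 => tnorm (A - C))
         (gqt_factorizable mu k)
         (gqt_trunc mu U S V hk).
Proof.
have slice := gqt_svd_slices hn3 hsvd.
have Sd q (i : 'I_n1) (j : 'I_n2) : i <> j :> nat -> dft mu S q i j = 0.
  by have [_ _ _ [+ _ _]] := slice q; apply.
split; first exact: gqt_trunc_factorizable.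
move=> C [X [Y ->]]; apply: (tnorm_le_dft hn3 hmu) => q.
have dft_sub (B : tensor (quat R) n1 n2 n3) :
    dft mu (A - B) q = dft mu A q - dft mu B q.
  by rewrite -dftB; apply: eq_dft => t; rewrite !ffunE.
have [Aq Uq Vq Sq] := slice q.
rewrite !dft_sub dft_gqt_mul // dft_gqt_trunc // mxsub_truncproj //; first last.
- exact: Sd.
- exact: ltn_minn_leqr hk.
- exact: ltn_minn_leql hk.
rewrite Aq; apply: eckart_young => //.
by move: hk; rewrite leq_min => /andP[].
Qed.
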